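(* If $G$ is a connected subcubic graph of order $n$ and girth at least $7$, then $$\nu_{ur}(G)\geq \frac{n-1}{3}.$$
   Context: All graphs are simple, finite, and undirected. A graph is subcubic if every vertex has degree at most $3$. The order of a graph is its number of vertices. The girth of a graph is the length of a shortest cycle, with the convention that acyclic graphs have infinite girth (so trees satisfy the girth condition). A matching $M$ in a graph $G$ is uniquely restricted if no other matching in $G$ covers the same set of vertices as $M$. The uniquely restricted matching number $\nu_{ur}(G)$ is the maximum size (number of edges) of a uniquely restricted matching in $G$. *)

(* Defs.v *)
From mathcomp Require Import all_boot.

Set Implicit Arguments.
Unset Strict Implicit.
Unset Printing Implicit Defensive.

Record sgraph := SGraph {
  vertex :> finType;
  adj : rel vertex;
  adj_sym : symmetric adj;
  adj_irr : irreflexive adj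
}.

Section SimpleGraph.

Variable G : sgraph.

Definition degree (x : G) : nat := #|[set y | adj x y]|.

Definition subcubic : bool := [forall x : G, degree x <= 3].

(* The graph without vertices counts as connected here. *)
Definition connected : bool := [forall x : G, forall y : G, connect (@adj G) x y].

(* [ucycleb] also accepts sequences of size 0 and 2, which are not cycles of a
   simple graph. *)
Definition has_cycle (k : nat) : bool :=
  (2 < k) && [exists c : k.-tuple G, ucycleb (@adj G) c].

(* [None] is an infinite girth; no cycle is longer than #|G|. *)
Definition girth : option nat := ohead [seq k <- iota 0 #|G|.+1 | has_cycle k].

Definition girth_at_least (g : nat) : bool :=
  if girth is Some k then g <= k else true.

Lemma has_cycle_bound k : has_cycle k -> k <= #|G|.
Proof.
case/andP=> _ /existsP[c /andP[_ Uc]].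
by rewrite -[X in X <= _](size_tuple c) -(card_uniqP Uc) max_card.
Qed.

Lemma girth_at_leastP g :
  reflect (forall c : seq G, 2 < size c -> ucycle (@adj G) c -> g <= size c)
          (girth_at_least g).
Proof.
suff [gP gN]: (girth_at_least g <-> forall k, has_cycle k -> g <= k).
  apply: (iffP idP) => [/gP gk c c_gt2 Uc | gc].
    apply: gk; rewrite /has_cycle c_gt2 /=.
    by apply/existsP; exists (in_tuple c).
  apply: gN => k /andP[k_gt2 /existsP[c Uc]].
  by rewrite -(size_tuple c); apply: gc; rewrite ?size_tuple.
rewrite /girth_at_least /girth.
set s := [seq k <- _ | _].
have mem_s k: (k \in s) = has_cycle k.
  rewrite mem_filter mem_iota /= add0n ltnS.
  by case: (boolP (has_cycle k)) => // /has_cycle_bound ->.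
have s_sorted: sorted leq s.
  by apply: sorted_filter; [exact: leq_trans | exact: iota_sorted].
case: s mem_s s_sorted => [|k s] mem_s /= s_sorted.
  by split=> // _ k; rewrite -mem_s.
split=> [gk j | gk]; last by apply: gk; rewrite -mem_s mem_head.
rewrite -mem_s inE => /predU1P[-> // | sj].
exact: leq_trans gk (allP (order_path_min leq_trans s_sorted) j sj).
Qed.

Definition edges : {set {set G}} := [set [set x; y] | x in G, y in G & adj x y].

Definition matching (M : {set {set G}}) : bool :=
  (M \subset edges) && trivIset M.

Definition uniquely_restricted (M : {set {set G}}) : bool :=
  matching M &&
  [forall M' : {set {set G}},
     matching M' && (cover M' == cover M) ==> (M' == M)].

(* The maximum is over a nonempty family, since the empty matching is uniquely
   restricted. *)
Definition nu_ur : nat :=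
  \max_(M : {set {set G}} | uniquely_restricted M) #|M|.

Lemma edgesP (A : {set G}) :
  reflect (exists x y : G, adj x y /\ A = [set x; y]) (A \in edges).
Proof.
apply: (iffP imset2P) => [[x y _] | [x [y [xy ->]]]].
  by rewrite !inE => xy ->; exists x, y.
by exists x y; rewrite ?inE.
Qed.

Lemma uniquely_restricted0 : uniquely_restricted set0.
Proof.
rewrite /uniquely_restricted /matching sub0set /=; apply/andP; split.
  by apply/trivIsetP=> A B; rewrite inE.
apply/forallP=> M; apply/implyP=> /andP[/andP[/subsetP sM _]].
rewrite /cover big_set0 => /eqP M0; apply/eqP/setP=> A; rewrite inE.
apply/negP=> MA; have /edgesP[x [y [_ defA]]] := sM A MA.
have: x \in \bigcup_(B in M) B.
  by apply/bigcupP; exists A; rewrite // defA set21.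
by rewrite M0 inE.
Qed.

End SimpleGraph.

(* Main.v *)
Require Import Defs.
From HB Require Import structures.
From mathcomp Require Import all_boot all_order all_algebra.
From mathcomp Require Import zify.
Import Order.TTheory GRing.Theory Num.Theory.

(** The bound is proved for all vertex sets [S] of the graph, by deleting small
sets of vertices while building the matching. If a vertex [x] has a single
neighbour [y] in what is left, then [xy] can be added to any uniquely restricted
matching of the rest ([ur_number_pendant]). So an edge may be gained by deleting
a leaf with its neighbour, or, if [u] has two neighbours [v] and [w], by
discarding [w] and matching [u] with [v]. The budget is three vertices per edge.

What can spoil the budget are components such as a single vertex, on which even
the best matching falls short of a third of the order. The ones that matter are
the [tight] trees, subcubic with [3 * k + 1] vertices and no matching of more than
[k] edges. Without components of this kind, and without cubic ones, a third of the
order is always reached ([card_le_ur_number]):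

- deleting a leaf and its neighbour costs only two vertices, so one tight
  component may arise; two of them would mean that there was a tight component
  before ([card_le_ur_number_pendant]);

- when all degrees are at least two, deleting a vertex [u] of degree two together
  with its two neighbours costs three vertices, and no tight component arises at
  all ([no_tight_component_degree2]): it would have many leaves, which all attach
  to the two neighbours of [u], and its diameter is so small that a cycle of
  length at most six appears. This is the point where girth 7 is needed.

Proper subsets of a connected subcubic graph never induce cubic components
([degenerate_proper]). A connected graph that is not covered by this is a tight
tree or cubic. For a tight tree the bound holds by construction; in a cubic graph
the closed neighbourhood of a vertex is deleted first, for one edge and four
vertices, and a 4-cycle would be needed to produce a tight component
([no_tight_component_cubic]). In both cases a third of the order is missed by at
most one vertex, which is the 1 in the statement. *)

Section UniquelyRestricted.
Set Implicit Arguments.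
Unset Strict Implicit.

Variable G : sgraph.
Implicit Types (x y z a : G) (A B C R S T : {set G}) (M : {set {set G}}).

(** * Neighbourhoods inside a vertex set, and separated sets *)

Definition nbhd S x : {set G} := [set y in S | adj x y].

Definition separated A B : bool :=
  [forall a in A, forall b in B, (a != b) && ~~ adj a b].

Lemma separatedP A B :
  reflect {in A & B, forall a b, a != b /\ ~~ adj a b} (separated A B).
Proof.
apply: (iffP 'forall_in_forall_inP) => sAB a b Aa Bb.
  by apply/andP; exact: sAB.
by apply/andP; exact: sAB.
Qed.

Lemma separatedC A B : separated A B = separated B A.
Proof.
suff sep_sym U V : separated U V -> separated V U by apply/idP/idP; exact: sep_sym.
move=> /separatedP sUV; apply/separatedP => a b Va Ub.
by rewrite eq_sym adj_sym; exact: sUV.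
Qed.

Lemma separatedUr A B C : separated A B -> separated A C -> separated A (B :|: C).
Proof.
move=> /separatedP sAB /separatedP sAC; apply/separatedP => a b Aa.
by case/setUP; [exact: sAB | exact: sAC].
Qed.

Lemma separatedS A A' B B' :
  A \subset A' -> B \subset B' -> separated A' B' -> separated A B.
Proof.
move=> /subsetP sA /subsetP sB /separatedP sAB.
by apply/separatedP => a b /sA Aa /sB Bb; exact: sAB.
Qed.

Lemma separated_notin A B a : separated A B -> a \in A -> a \notin B.
Proof. by move=> /separatedP sAB Aa; apply/negP => /(sAB _ _ Aa)[/eqP]. Qed.

Lemma separated_disjoint A B : separated A B -> [disjoint A & B].
Proof.
move=> sAB; apply/pred0P => a /=; apply/negbTE/negP => /andP[Aa].
exact/negP/(separated_notin sAB).
Qed.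

Lemma in_nbhd S x y : (y \in nbhd S x) = (y \in S) && adj x y.
Proof. by rewrite inE. Qed.

Lemma nbhdS S T x : S \subset T -> nbhd S x \subset nbhd T x.
Proof.
by move=> /subsetP sST; apply/subsetP => y; rewrite !in_nbhd => /andP[/sST-> ->].
Qed.

Lemma adj_neq x y : adj x y -> x != y.
Proof. by apply: contraTneq => ->; rewrite adj_irr. Qed.

Lemma separated_nbhd0 S x : separated [set x] S -> nbhd S x = set0.
Proof.
move=> /separatedP sxS; apply/setP => z; rewrite in_nbhd in_set0.
apply/negbTE/negP => /andP[Sz]; apply/negP.
by have [] := sxS x z (set11 x) Sz.
Qed.

(** * Uniquely restricted matchings inside a vertex set *)

Definition ur_number S : nat :=
  \max_(M : {set {set G}} | uniquely_restricted M && (cover M \subset S)) #|M|.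

(** Being uniquely restricted depends only on the graph induced on the covered
vertices. There [x] has no neighbour but [y], so every matching that covers [x]
uses the edge [xy], and the rest of it covers exactly what [M] covers. *)
Lemma uniquely_restrictedU1 M S x y :
    uniquely_restricted M -> cover M \subset S ->
    x \notin S -> y \notin S -> adj x y -> nbhd S x = set0 ->
  uniquely_restricted ([set x; y] |: M) /\ [set x; y] \notin M.
Proof.
move=> /andP[/andP[ME triM] /forallP urM] MS xS yS xy Nx.
have notM z : z \notin S -> z \notin cover M by apply: contra => /(subsetP MS).
have A0 B : B \in M -> [disjoint [set x; y] & B].
  move=> MB; rewrite disjoint_subset; apply/subsetP => z.
  rewrite !inE => zxy; apply/negP => Bz.
  have Mz: z \in cover M by apply/bigcupP; exists B.
  by case/orP: zxy Mz => /eqP->; apply/negP/notM.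
have M0: set0 \notin M.
  apply/negP => /(subsetP ME)/edgesP[a [b [_ /setP/(_ a)]]].
  by rewrite !inE eqxx.
have [triM1 AM] := trivIsetU1 A0 triM M0.
have Axy: [set x; y] \in edges G by apply/edgesP; exists x, y.
have covM1: cover ([set x; y] |: M) = [set x; y] :|: cover M.
  by rewrite /cover big_setU1.
split=> //; apply/andP; split.
  by rewrite /matching triM1 andbT subUset sub1set Axy.
apply/forallP => N; apply/implyP => /andP[/andP[NE triN] /eqP covN].
have: x \in cover N by rewrite covN covM1 !inE eqxx.
case/bigcupP => B NB Bx.
have NxyB: B = [set x; y].
  have /edgesP[a [b [ab defB]]] := subsetP NE _ NB.
  have [z xz defBz]: exists2 z, adj x z & B = [set x; z].
    move: Bx; rewrite defB !inE => /orP[]/eqP->; first by exists b.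
    by exists a; rewrite 1?adj_sym // setUC.
  have: z \in cover N by apply/bigcupP; exists B; rewrite // defBz !inE eqxx orbT.
  rewrite covN covM1 !inE -orbA => /or3P[/eqP zx|/eqP zy|].
  - by rewrite zx adj_irr in xz.
  - by rewrite defBz zy.
  - move=> /(subsetP MS) Sz.
    have: z \in nbhd S x by rewrite in_nbhd Sz.
    by rewrite Nx inE.
subst B.
have /implyP/(_ _)/eqP <- := urM (N :\ [set x; y]); first by rewrite setD1K.
apply/andP; split.
  rewrite /matching (trivIsetS _ triN) ?subsetDl // andbT.
  exact: subset_trans (subsetDl _ _) NE.
rewrite coverD1 // covN covM1; apply/eqP/setP => z; rewrite !inE.
case: (z =P x) => [->|_] /=; first by rewrite (negbTE (notM _ xS)).
by case: (z =P y) => [->|_] //=; rewrite (negbTE (notM _ yS)).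
Qed.

(** The step on which every reduction rests: once all neighbours of [x] other
than [y] are thrown away, [xy] can join any uniquely restricted matching of what
remains. *)
Lemma ur_number_pendant S S' x y :
    S' \subset S -> x \in S :\: S' -> y \in S :\: S' -> adj x y ->
    nbhd S' x = set0 ->
  ur_number S' < ur_number S.
Proof.
move=> sS' /setDP[Sx xS'] /setDP[Sy yS'] xy Nx.
have [|M /andP[urM MS'] maxM] := @eq_bigmax_cond _
    (fun M => uniquely_restricted M && (cover M \subset S')) (fun M => #|M|).
  apply/card_gt0P; exists set0.
  by rewrite unfold_in uniquely_restricted0 /cover big_set0 sub0set.
have -> : ur_number S' = #|M| := maxM.
have [urM1 AM] := uniquely_restrictedU1 urM MS' xS' yS' xy Nx.
rewrite /ur_number -add1n -[1]/(true : nat) -AM -cardsU1.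
apply: (leq_bigmax_cond (P := fun M => uniquely_restricted M && (cover M \subset S))).
rewrite urM1 /cover big_setU1 //= !subUset !sub1set Sx Sy.
exact: subset_trans MS' sS'.
Qed.

Lemma ur_numberT : ur_number setT = nu_ur G.
Proof. by apply: eq_bigl => M; rewrite subsetT andbT. Qed.

(** * Tight trees *)

(** In a subcubic graph, the vertex sets of the induced trees with [3 * k + 1]
vertices that have no matching of more than [k] edges: [x] is a leaf, its
neighbour [y] has degree three, and removing both leaves two smaller sets of the
same kind, attached to [y] at [a1] and [a2]. Building them up from leaves, rather
than through matchings, is what makes counting their leaves and bounding their
diameter possible by induction. *)
Inductive tight : nat -> {set G} -> Prop :=
| tight_vertex z : tight 0 [set z]
| tight_join k1 k2 C1 C2 x y a1 a2 of
    tight k1 C1 & tight k2 C2 & separated C1 C2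
    & separated [set x] (C1 :|: C2) & y \notin C1 :|: C2
    & adj x y & nbhd C1 y = [set a1] & nbhd C2 y = [set a2] :
    tight (k1 + k2).+1 (x |: (y |: (C1 :|: C2))).

(** Tight sets are connected, so [C] is indeed a component of the graph induced on
[S]. *)
Definition tight_component C S : Prop :=
  [/\ exists k, tight k C, C \subset S & separated C (S :\: C)].

(** The least number of edges that must leave [C] if every vertex of [C] is to
have degree at least two in the surrounding graph; the truncated subtraction
makes vertices of degree three inside [C] count for nothing. *)
Definition deficiency C : nat := \sum_(z in C) (2 - #|nbhd C z|).

(** Linear arithmetic that takes all set sizes and matching numbers as unknowns. *)
Ltac size_lia :=
  repeat match goal with
  | H : is_true (leq _ _) |- _ => revert H
  | H : @eq nat _ _ |- _ => revert H
  end;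
  repeat match goal with
  | |- context [card ?A] => generalize (card A)
  | |- context [ur_number ?A] => generalize (ur_number A)
  | |- context [deficiency ?A] => generalize (deficiency A)
  | |- context [bigop ?a ?b ?c] => generalize (bigop a b c)
  end;
  clear; intros; lia.

Lemma card_tight k C : tight k C -> #|C| = 3 * k + 1.
Proof.
elim=> {k C} [z|k1 k2 C1 C2 x y a1 a2 _ c1 _ c2 s12 sx yC xy _ _].
  by rewrite cards1.
have xC: x \notin C1 :|: C2 by apply: (separated_notin sx); rewrite inE.
rewrite !cardsU1 yC in_setU1 (negbTE xC) (negbTE (adj_neq xy)) cardsU.
have:= separated_disjoint s12; rewrite -setI_eq0 => /eqP->.
rewrite cards0 c1 c2 /=; size_lia.
Qed.

(** The presence of [R] lets the induction treat the two halves of a tight set one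
after the other. *)
Lemma ur_number_tightU k C R :
  tight k C -> separated C R -> k + ur_number R <= ur_number (C :|: R).
Proof.
move=> tC; elim: tC R => {k C} [z|k1 k2 C1 C2 x y a1 a2 _ f1 _ f2 s12 sx yC xy _ _] R sR.
  rewrite add0n; apply/bigmax_leqP => M /andP[urM MR].
  apply: leq_bigmax_cond; rewrite urM /=.
  exact: subset_trans MR (subsetUr _ _).
set C := x |: _ in sR *.
have sC12: C1 :|: C2 \subset C by rewrite /C setUA subsetUr.
have sub1: C1 \subset C := subset_trans (subsetUl _ _) sC12.
have sub2: C2 \subset C := subset_trans (subsetUr _ _) sC12.
have Cx: x \in C by rewrite !inE eqxx.
have Cy: y \in C by rewrite !inE eqxx orbT.
have sR1: separated C1 (C2 :|: R).
  by apply: separatedUr => //; apply: separatedS sR.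
have sR2: separated C2 R by apply: separatedS sR.
have sxR: separated [set x] (C1 :|: C2 :|: R).
  by apply: separatedUr => //; apply: separatedS sR; rewrite ?sub1set.
have xCR: x \notin C1 :|: C2 :|: R by apply: (separated_notin sxR); rewrite inE.
have yCR: y \notin C1 :|: C2 :|: R.
  by rewrite in_setU negb_or yC (separated_notin sR).
have lt_f: ur_number (C1 :|: C2 :|: R) < ur_number (C :|: R).
  apply: (@ur_number_pendant _ _ x y) => //.
  - exact: setSU.
  - by rewrite in_setD xCR in_setU Cx.
  - by rewrite in_setD yCR in_setU Cy.
  - exact: separated_nbhd0.
rewrite addSn; apply: leq_ltn_trans lt_f; rewrite -addnA -setUA.
by apply: leq_trans (f1 _ sR1); rewrite leq_add2l; exact: f2.
Qed.

Lemma nbhd_join C1 C2 x y a z :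
    separated C1 C2 -> separated [set x] (C1 :|: C2) -> nbhd C1 y = [set a] ->
    z \in C1 ->
  #|nbhd (x |: (y |: (C1 :|: C2))) z| <= #|nbhd C1 z| + (z == a).
Proof.
move=> s12 sx Ny C1z.
have zy: adj z y = (z == a) by rewrite adj_sym; move/setP/(_ z): Ny; rewrite !inE C1z.
have -> : (z == a : nat) = #|if z == a then [set y] else set0|.
  by case: ifP; rewrite ?cards1 ?cards0.
apply: leq_trans (subset_leq_card _) (leq_card_setU _ _); apply/subsetP => w.
rewrite in_setU !in_nbhd !in_setU !in_set1 => /andP[/or4P[/eqP->|/eqP->|C1w|C2w] zw].
- have /separatedP/(_ x z)[|/=|_] := sx; rewrite ?inE ?C1z //.
  by rewrite adj_sym zw.
- by rewrite -zy zw inE eqxx orbT.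
- by rewrite C1w zw.
- by have /separatedP/(_ z w C1z C2w)[_] := s12; rewrite zw.
Qed.

Lemma deficiency_join C1 C2 x y a :
    separated C1 C2 -> separated [set x] (C1 :|: C2) -> nbhd C1 y = [set a] ->
  deficiency C1 <=
    (\sum_(z in C1) (2 - #|nbhd (x |: (y |: (C1 :|: C2))) z|)).+1.
Proof.
move=> s12 sx Ny.
have C1a: a \in C1 by have: a \in nbhd C1 y; [rewrite Ny inE | rewrite inE => /andP[]].
rewrite /deficiency (bigD1 a C1a) [in leqRHS](bigD1 a C1a) /= -addSn.
apply: leq_add; last apply: leq_sum => z /andP[C1z za].
  by have:= nbhd_join s12 sx Ny C1a; rewrite eqxx; size_lia.
by have:= nbhd_join s12 sx Ny C1z; rewrite (negbTE za); size_lia.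
Qed.

(** A tight set has many leaves. Joining two of them through [y] makes [a1] and
[a2] lose one unit each, while the new leaf [x] brings one: the excess over [k]
stays at least two. *)
Lemma deficiency_tight k C : tight k C -> k + 2 <= deficiency C.
Proof.
elim=> {k C} [z|k1 k2 C1 C2 x y a1 a2 _ d1 _ d2 s12 sx yC xy Ny1 Ny2].
  rewrite /deficiency big_set1 (_ : nbhd _ _ = set0) ?cards0 //.
  by apply/setP => w; rewrite !inE; case: eqP => // ->; rewrite adj_irr.
have xC: x \notin C1 :|: C2 by apply: (separated_notin sx); rewrite inE.
have e1 := deficiency_join s12 sx Ny1.
have:= @deficiency_join C2 C1 x y a2.
rewrite separatedC (setUC C2 C1) => /(_ s12 sx Ny2) e2.
rewrite /deficiency big_setU1 /=; last first.
  by rewrite in_setU1 negb_or xC (adj_neq xy).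
rewrite big_setU1 //= (eq_bigl [predU C1 & C2]) => [|z]; last by rewrite !inE.
rewrite bigU ?separated_disjoint //=.
have Nx: #|nbhd (x |: (y |: (C1 :|: C2))) x| <= 1.
  rewrite -(cards1 y); apply: subset_leq_card; apply/subsetP => w.
  rewrite in_nbhd !in_setU1 => /andP[/or3P[/eqP->|/eqP->|Cw] xw]; rewrite ?inE //.
    by rewrite adj_irr in xw.
  by have /separatedP/(_ x w)[|//|_] := sx; rewrite ?inE ?xw.
move: e1 e2 Nx d1 d2; size_lia.
Qed.

Definition linked C d z z' : Prop :=
  exists p, [/\ path (@adj G) z p, last z p = z', {subset p <= C} & size p <= d].

Lemma linkedW C C' d d' z z' :
  C \subset C' -> d <= d' -> linked C d z z' -> linked C' d' z z'.
Proof.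
move=> /subsetP sC led [p [zp lp pC dp]]; exists p; split=> //.
  by move=> w /pC/sC.
exact: leq_trans led.
Qed.

Lemma linked_trans C d d' z w z' :
  linked C d z w -> linked C d' w z' -> linked C (d + d') z z'.
Proof.
move=> [p [zp <- pC dp]] [q [zq lq qC dq]]; exists (p ++ q).
split; rewrite ?cat_path ?zp ?last_cat ?size_cat ?leq_add //.
by move=> v; rewrite mem_cat => /orP[/pC|/qC].
Qed.

Lemma linked_sym C d z z' : z \in C -> linked C d z z' -> linked C d z' z.
Proof.
move=> Cz [p [zp <- pC dp]]; exists (rev (belast z p)); split.
- rewrite rev_path; apply: sub_path zp => v w; by rewrite adj_sym.
- by case: p {zp pC dp} => //= w p; rewrite rev_cons last_rcons.
- move=> v; rewrite mem_rev => /mem_belast; rewrite inE => /predU1P[-> //|]; exact: pC.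
- by rewrite size_rev size_belast.
Qed.

Lemma linked_adj C z z' : z' \in C -> adj z z' -> linked C 1 z z'.
Proof.
move=> Cz' zz'; exists [:: z']; split; rewrite //= ?zz' //.
by move=> v; rewrite inE => /eqP->.
Qed.

(** The diameter grows slowly: a route between two vertices that do not lie in the
same half passes through [y]. *)
Lemma linked_tight k C : tight k C -> {in C &, forall z z', linked C (2 * k) z z'}.
Proof.
elim=> {k C} [z|k1 k2 C1 C2 x y a1 a2 _ l1 _ l2 s12 sx yC xy Ny1 Ny2].
  by move=> z1 z2 /set1P-> /set1P->; exists [::].
have [le1 le2]: 2 * k1 <= 2 * (k1 + k2).+1 /\ 2 * k2 <= 2 * (k1 + k2).+1 by size_lia.
set C := x |: _.
have sC12: C1 :|: C2 \subset C by rewrite /C setUA subsetUr.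
have sub1: C1 \subset C := subset_trans (subsetUl _ _) sC12.
have sub2: C2 \subset C := subset_trans (subsetUr _ _) sC12.
have Cy: y \in C by rewrite !inE eqxx orbT.
have to_y (Ci : {set G}) (ki : nat) (a z : G) :
    Ci \subset C -> {in Ci &, forall z z', linked Ci (2 * ki) z z'} ->
    nbhd Ci y = [set a] -> z \in Ci -> linked C (2 * ki).+1 z y.
  move=> subi li Ny Ciz; have: a \in nbhd Ci y by rewrite Ny inE.
  rewrite in_nbhd adj_sym => /andP[Cia ay]; rewrite -addn1.
  apply: (linked_trans (w := a)); last exact: linked_adj.
  by apply: linkedW (li _ _ Ciz Cia).
(* An upper bound on the distance from [z] to [y]. *)
pose e z := if z \in C1 then (2 * k1).+1 else if z \in C2 then (2 * k2).+1
            else if z == y then 0 else 1.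
have eP z: z \in C -> linked C (e z) z y.
  rewrite /e; case: ifP => [C1z _|C1z]; first exact: (to_y C1 k1 a1).
  case: ifP => [C2z _|C2z]; first exact: (to_y C2 k2 a2).
  rewrite !inE C1z C2z !orbF; case: (eqVneq z y) => [-> _|_]; first by exists [::].
  by rewrite orbF => /eqP->; exact: linked_adj.
have via_y z z' : z \in C -> z' \in C -> linked C (e z + e z') z z'.
  move=> Cz Cz'; apply: (linked_trans (eP z Cz)).
  exact: linked_sym (eP z' Cz').
move=> z z' Cz Cz'.
have [/andP[C1z C1z']|] := boolP ((z \in C1) && (z' \in C1)).
  exact: (linkedW sub1 le1 (l1 _ _ C1z C1z')).
have [/andP[C2z C2z'] _|] := boolP ((z \in C2) && (z' \in C2)).
  exact: (linkedW sub2 le2 (l2 _ _ C2z C2z')).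
move=> n2 n1; apply: linkedW (via_y z z' Cz Cz') => //; rewrite /e.
clear -n1 n2; move: n1 n2; case: (z \in C1); case: (z' \in C1) => //= _;
  case: (z \in C2); case: (z' \in C2) => //= _.
all: by case: (z == y); case: (z' == y); size_lia.
Qed.

(** * Excluding tight components by girth and degrees *)

Lemma girth_le_linked g C d v z z' :
    girth_at_least G g -> v \notin C -> z \in C -> z != z' -> linked C d z z' ->
  adj v z -> adj v z' -> g <= d + 2.
Proof.
move=> /girth_at_leastP girthG vC Cz zz' [p [zp lp pC dp]] vz vz'.
case: (shortenP zp) lp => q zq Uq sub_qp lq.
have q_gt0: 0 < size q by case: q lq {zq Uq sub_qp} => //= ezz'; rewrite ezz' eqxx in zz'.
have le_qp: size q <= size p by apply: uniq_leq_size sub_qp; case/andP: Uq.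
suff Ucyc: ucycle (@adj G) [:: v, z & q].
  apply: leq_trans (girthG _ _ Ucyc) _; first by rewrite /= !ltnS.
  by rewrite /= addn2 !ltnS; exact: leq_trans le_qp dp.
apply/andP; split.
  by rewrite /= rcons_path vz zq lq adj_sym.
rewrite cons_uniq Uq andbT inE negb_or; apply/andP; split.
  by apply: contraNneq vC => ->.
by apply: contra vC => /sub_qp/pC.
Qed.

Lemma card_nbhd_le3 S x : subcubic G -> #|nbhd S x| <= 3.
Proof.
move=> /forallP/(_ x); apply: leq_trans; apply: subset_leq_card.
by apply/subsetP => y; rewrite !inE => /andP[].
Qed.

Lemma card_nbhd_sum C v : #|nbhd C v| = \sum_(z in C) adj z v.
Proof.
rewrite -sum1_card big_mkcond [in RHS]big_mkcond; apply: eq_bigr => z _.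
by rewrite in_nbhd adj_sym; case: (z \in C); case: (adj z v).
Qed.

Lemma card_nbhd_separated C S X z :
    separated C (S :\: X :\: C) -> z \in C ->
  #|nbhd S z| <= #|nbhd C z| + #|nbhd X z|.
Proof.
move=> /separatedP sC Cz; apply: leq_trans (leq_card_setU _ _).
apply: subset_leq_card; apply/subsetP => b; rewrite in_setU !in_nbhd => /andP[Sb zb].
rewrite zb !andbT; case: (boolP (b \in C)) => //= bC.
apply: contraT => bX; have [|_] := sC z b Cz; last by rewrite zb.
by rewrite !in_setD bC bX.
Qed.

(** Here the girth is used in full. A tight component [C] on [3 * k + 1] vertices
sends at least [k + 2] edges to [v] and [w], which can take only two each, so
[k <= 2]. Then two vertices of [C] are at distance at most 4, hence two
neighbours of [v] in [C] would lie on a cycle of length at most 6. So [v] and [w]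
have at most one neighbour each, [k = 0], and the only vertex of [C] closes a
4-cycle with [v], [u] and [w]. *)
Lemma no_tight_component_degree2 S u v w :
    subcubic G -> girth_at_least G 7 -> {in S, forall z, 2 <= #|nbhd S z|} ->
    u \in S -> v != w -> nbhd S u = [set v; w] ->
  forall C, ~ tight_component C (S :\: [set u; v; w]).
Proof.
move=> cubG girthG minS Su vw Nu C [[k tC] /subsetP CS sC].
have [uv uw]: adj u v /\ adj u w.
  move/setP: Nu => Nu; have:= Nu v; have:= Nu w.
  by rewrite !inE !eqxx ?orbT => /andP[_ ->] /andP[_ ->].
have CX b : b \in C -> [/\ b \in S, b != u, b != v & b != w].
  by move/CS; rewrite in_setD !inE !negb_or => /andP[/andP[/andP[-> ->] ->] ->].
have uC: u \notin C by apply/negP => /CX[_ /eqP].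
have vC: v \notin C by apply/negP => /CX[_ _ /eqP].
have wC: w \notin C by apply/negP => /CX[_ _ _ /eqP].
have defC: deficiency C <= #|nbhd C v| + #|nbhd C w|.
  rewrite !card_nbhd_sum -big_split /=; apply: leq_sum => z Cz.
  have [Sz zu zv zw] := CX z Cz.
  have := card_nbhd_separated sC Cz.
  have: #|nbhd [set u; v; w] z| <= adj z v + adj z w.
    have uz: adj z u = false.
      apply/negbTE/negP => zu'; have: z \in nbhd S u by rewrite in_nbhd Sz adj_sym.
      by rewrite Nu !inE (negbTE zv) (negbTE zw).
    have sub: nbhd [set u; v; w] z \subset
        (if adj z v then [set v] else set0) :|: (if adj z w then [set w] else set0).
      apply/subsetP => b; rewrite in_nbhd !inE => /andP[/orP[/orP[]|]/eqP-> zb].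
      - by rewrite uz in zb.
      - by rewrite zb inE eqxx.
      - by rewrite zb [_ \in [set w]]inE eqxx orbT.
    apply: leq_trans (subset_leq_card sub) _; apply: leq_trans (leq_card_setU _ _) _.
    by apply: leq_add; case: ifP => _; rewrite ?cards1 ?cards0.
  have:= minS z Sz; size_lia.
have few q : adj u q -> #|nbhd C q| <= 2.
  move=> uq; have := card_nbhd_le3 (u |: C) q cubG.
  have -> : nbhd (u |: C) q = u |: nbhd C q.
    apply/setP => b; rewrite !inE andb_orl.
    by case: (eqVneq b u) => [->|] //=; rewrite adj_sym uq.
  by rewrite cardsU1 in_nbhd (negbTE uC).
have one q : q \notin C -> k <= 2 -> #|nbhd C q| <= 1.
  move=> qC k2; rewrite leqNgt; apply/negP => /card_gt1P[z [z' []]].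
  rewrite !in_nbhd => /andP[Cz qz] /andP[Cz' qz'] zz'.
  have:= girth_le_linked girthG qC Cz zz' (linked_tight tC Cz Cz') qz qz'; size_lia.
have:= deficiency_tight tC; have:= few _ uv; have:= few _ uw => fw fv defk.
have k2: k <= 2 by size_lia.
have [v1 w1] := (one v vC k2, one w wC k2).
have k0: k = 0 by size_lia.
have /card_gt0P[z1]: 0 < #|nbhd C v| by size_lia.
have /card_gt0P[z2]: 0 < #|nbhd C w| by size_lia.
rewrite !in_nbhd => /andP[Cz2 wz2] /andP[Cz1 vz1].
have [p [_ e12 _ p0]] := linked_tight tC Cz1 Cz2.
have {p p0} e12: z1 = z2 by case: p e12 p0 => //=; rewrite k0.
have lvw: linked [set v; w; z1] 2 v w.
  apply: (linked_trans (w := z1) (d := 1) (d' := 1));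
    apply: linked_adj; rewrite ?inE ?eqxx ?orbT //.
  by rewrite e12 adj_sym.
have [_ z1u _ _] := CX z1 Cz1.
have uvwz: u \notin [set v; w; z1].
  by rewrite !inE !negb_or (adj_neq uv) (adj_neq uw) eq_sym.
by have:= girth_le_linked girthG uvwz _ vw lvw uv uw; rewrite !inE eqxx => /(_ isT).
Qed.

(** A vertex of degree at most one in a tight component [C] has two neighbours
outside [C], both adjacent to [u]: a 4-cycle. *)
Lemma no_tight_component_cubic u :
    girth_at_least G 7 -> (forall z, 3 <= #|nbhd setT z|) ->
  forall C, ~ tight_component C (setT :\: (u |: nbhd setT u)).
Proof.
move=> girthG cubG C [[k tC] /subsetP CS sC].
have [z Cz Nz]: exists2 z, z \in C & #|nbhd C z| <= 1.
  apply/exists_inP; apply: contraT; rewrite negb_exists_in => /forall_inP bigC.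
  have: deficiency C = 0; last by have := deficiency_tight tC; size_lia.
  by apply: big1 => z Cz; have:= bigC z Cz; size_lia.
have: z \notin u |: nbhd setT u by have := CS z Cz; rewrite in_setD => /andP[].
rewrite in_setU1 in_nbhd inE negb_or => /andP[zu uz].
have := card_nbhd_separated sC Cz.
have:= cubG z => z3 zS.
have /card_gt1P[a [b []]]: 1 < #|nbhd (u |: nbhd setT u) z| by size_lia.
have Nu c : c \in nbhd (u |: nbhd setT u) z -> adj u c /\ adj z c.
  rewrite in_nbhd in_setU1 in_nbhd in_setT /= => /andP[/predU1P[->|uc] zc] //.
  by rewrite adj_sym zc in uz.
move=> /Nu[ua za] /Nu[ub zb] ab.
have lab: linked [set a; b; z] 2 a b.
  apply: (linked_trans (w := z) (d := 1) (d' := 1));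
    apply: linked_adj; rewrite ?inE ?eqxx ?orbT //.
  by rewrite adj_sym.
have uabz: u \notin [set a; b; z].
  by rewrite !inE !negb_or (adj_neq ua) (adj_neq ub) eq_sym.
by have:= girth_le_linked girthG uabz _ ab lab ua ub; rewrite !inE eqxx => /(_ isT).
Qed.

(** * The induction *)

(** The hypothesis that each nonempty subset has a vertex with at most two
neighbours in it replaces the condition that no component is cubic: it passes to
subsets, so the induction never has to look for cubic components. *)
Definition degenerate S : Prop :=
  forall T, T \subset S -> T != set0 -> exists2 t, t \in T & #|nbhd T t| <= 2.

(** Matching the leaf [x] with [y] costs two vertices, which leaves room for one
vertex to be lost in a tight component of the rest. Such a component must touch
[y], since it would otherwise be one of [S]. The vertex [y] has only two
neighbours besides [x], so if there were two such components, they would form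
together with [x] and [y] a tight component of [S]. *)
Lemma card_le_ur_number_pendant S x y :
    subcubic G -> (forall C, ~ tight_component C S) ->
    x \in S -> nbhd S x = [set y] ->
    (forall R, R \proper S -> (forall C, ~ tight_component C R) ->
       #|R| <= 3 * ur_number R) ->
  #|S| <= 3 * ur_number S.
Proof.
move=> cubG noS Sx Nx IH.
have [Sy xy]: y \in S /\ adj x y.
  by apply/andP; rewrite -in_nbhd Nx inE.
have onlyy b : b \in S -> adj x b -> b = y.
  move=> Sb xb; have: b \in nbhd S x by rewrite in_nbhd Sb.
  by rewrite Nx => /set1P.
pose S' := S :\: [set x; y].
have S'P b : b \in S' = [&& b != x, b != y & b \in S].
  by rewrite in_setD !inE negb_or andbA.
have sub' : S' \subset S := subsetDl _ _.
have lt_f: ur_number S' < ur_number S.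
  apply: (@ur_number_pendant _ _ x y) => //.
  - by rewrite in_setD Sx andbT S'P eqxx.
  - by rewrite in_setD Sy andbT S'P eqxx andbF.
  apply/setP => b; rewrite in_nbhd S'P in_set0.
  apply/negbTE/negP => /andP[/and3P[_ byy Sb] xb].
  by rewrite (onlyy b Sb xb) eqxx in byy.
have cardS: #|S| = #|S'| + 2.
  rewrite -(cardsID [set x; y] S) addnC; congr (_ + _).
  rewrite (setIidPr _) ?cards2 ?(adj_neq xy) //.
  by rewrite subUset !sub1set Sx.
have properS R : R \subset S' -> R \proper S.
  move=> sR; apply: sub_proper_trans sR _; apply/properP; split=> //.
  by exists x => //; rewrite S'P eqxx.
(* [R] stands for what has been split off already: nothing, or the first tight
component when [C] is the second one. *)
have touch C R : C \subset S' -> separated C (S' :\: (C :|: R)) ->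
    separated C R -> (exists k, tight k C) -> 0 < #|nbhd C y|.
  move=> sC sep1 sep2 tC; rewrite lt0n; apply/negP => /eqP/cards0_eq Ny.
  apply: (noS C); split=> //; first exact: subset_trans sub'.
  apply/separatedP => a b Ca /setDP[Sb bC].
  have := subsetP sC _ Ca; rewrite S'P => /and3P[ax ay Sa].
  split; first by apply: contraNneq bC => <-.
  case: (eqVneq b x) => [->|bx].
    by apply: contra ay; rewrite adj_sym => /(onlyy _ Sa)->.
  case: (eqVneq b y) => [->|byy].
    apply/negP => ay'; have: a \in nbhd C y by rewrite in_nbhd Ca adj_sym.
    by rewrite Ny inE.
  case: (boolP (b \in R)) => [Rb|bR]; first by have /separatedP/(_ a b Ca Rb)[] := sep2.
  have /separatedP/(_ a b Ca)[] // := sep1.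
  by rewrite in_setD in_setU negb_or bC bR S'P bx byy.
(* Tightness is not decidable by construction, but the goal is boolean. *)
apply: (@classic_EM (exists C, tight_component C S'))
  => -[[C1 [[k1 t1] sC1 sep1]]|no1]; last first.
  have:= IH S' (properS _ (subxx _)) (fun C tC => no1 (ex_intro _ C tC)); size_lia.
have f1: k1 + ur_number (S' :\: C1) <= ur_number S'.
  have -> : ur_number S' = ur_number (C1 :|: (S' :\: C1)).
    by rewrite -{1}(setID S' C1) (setIidPr sC1).
  exact: ur_number_tightU.
have card1: #|S'| = #|S' :\: C1| + (3 * k1 + 1).
  by rewrite -(card_tight t1) -(cardsID C1 S') (setIidPr sC1) addnC.
apply: (@classic_EM (exists C, tight_component C (S' :\: C1)))
  => -[[C2 [[k2 t2] sC2 sep2]]|no2]; last first.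
  have:= IH _ (properS _ (subsetDl S' C1)) (fun C tC => no2 (ex_intro _ C tC)); size_lia.
exfalso.
have sC2': C2 \subset S' := subset_trans sC2 (subsetDl _ _).
have s12: separated C1 C2 by apply: separatedS sep1.
have y1: 0 < #|nbhd C1 y|.
  apply: (touch C1 set0); rewrite ?setU0 //; last by exists k1.
  by apply/separatedP => a b _; rewrite inE.
have y2: 0 < #|nbhd C2 y|.
  apply: (touch C2 C1); rewrite 1?separatedC //; last by exists k2.
  by rewrite separatedC setUC -setDDl.
have sub_y: x |: (nbhd C1 y :|: nbhd C2 y) \subset nbhd S y.
  rewrite !subUset sub1set in_nbhd Sx adj_sym xy /=.
  by rewrite !nbhdS // (subset_trans _ sub').
have card_y: #|x |: (nbhd C1 y :|: nbhd C2 y)| = (#|nbhd C1 y| + #|nbhd C2 y|).+1.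
  rewrite cardsU1 cardsU (_ : _ :&: _ = set0); last first.
    apply/setP => b; rewrite in_setI !in_nbhd in_set0; apply/negbTE/negP.
    by case/andP=> /andP[/(separated_notin s12)/negP ? _] /andP[].
  rewrite in_setU !in_nbhd cards0 subn0.
  have xC C : C \subset S' -> x \in C = false.
    by move=> sC; apply/negbTE/negP => /(subsetP sC); rewrite S'P eqxx.
  by rewrite !xC.
have := card_nbhd_le3 S y cubG.
have := subset_leq_card sub_y; rewrite card_y => le_y le_3.
have [a1 Ny1]: exists a, nbhd C1 y = [set a] by apply/cards1P/eqP; size_lia.
have [a2 Ny2]: exists a, nbhd C2 y = [set a] by apply/cards1P/eqP; size_lia.
have Ny: nbhd S y = x |: (nbhd C1 y :|: nbhd C2 y).
  by apply/esym/eqP; rewrite eqEcard sub_y card_y; size_lia.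
have C12P b : b \in C1 :|: C2 -> [&& b != x, b != y & b \in S].
  by rewrite -S'P => /setUP[/(subsetP sC1)|/(subsetP sC2')].
have sx: separated [set x] (C1 :|: C2).
  apply/separatedP => a b /set1P-> /C12P /and3P[bx byy Sb]; rewrite eq_sym; split=> //.
  by apply: contra byy => /(onlyy _ Sb)->.
have yC: y \notin C1 :|: C2 by apply/negP => /C12P/and3P[_ /eqP].
have tC := tight_join t1 t2 s12 sx yC xy Ny1 Ny2.
apply: (noS (x |: (y |: (C1 :|: C2)))); split; first by exists (k1 + k2).+1.
  rewrite !subUset !sub1set Sx Sy (subset_trans sC1 sub') /=.
  exact: subset_trans sC2' sub'.
apply/separatedP => a b Ca /setDP[Sb bC].
split; first by apply: contraNneq bC => <-.
move: bC; rewrite !in_setU !in_set1 !negb_or => /and4P[bx byy bC1 bC2].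
move: Ca; rewrite !in_setU !in_set1 => /or4P[/eqP->|/eqP->|C1a|C2a].
- by apply: contra byy => /(onlyy _ Sb)->.
- apply/negP => yb; have: b \in nbhd S y by rewrite in_nbhd Sb.
  by rewrite Ny !in_setU !in_nbhd in_set1 (negbTE bx) (negbTE bC1) (negbTE bC2).
- by have /separatedP/(_ a b C1a)[|//] := sep1; rewrite in_setD bC1 S'P bx byy.
- by have /separatedP/(_ a b C2a)[|//] := sep2; rewrite in_setD bC2 in_setD bC1 S'P bx byy.
Qed.

(** If no vertex has degree at most one in [S], some [u] has exactly two
neighbours [v] and [w]: match [u] with [v] and discard [w], which pays three
vertices for one edge and creates no tight component. *)
Lemma card_le_ur_number S :
    subcubic G -> girth_at_least G 7 -> degenerate S ->
    (forall C, ~ tight_component C S) ->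
  #|S| <= 3 * ur_number S.
Proof.
move=> cubG girthG; have [m] := ubnP #|S|; elim: m S => // m IHm S /ltnSE leSm degS noS.
have IH R : R \proper S -> (forall C, ~ tight_component C R) -> #|R| <= 3 * ur_number R.
  move=> ltRS; apply: IHm; first exact: leq_trans (proper_card ltRS) leSm.
  by move=> T sTR; apply: degS; exact: subset_trans sTR (proper_sub ltRS).
have [->|S0] := eqVneq S set0; first by rewrite cards0.
have [[x Sx Nx]|minS] :
    (exists2 x, x \in S & #|nbhd S x| <= 1) \/ {in S, forall z, 2 <= #|nbhd S z|}.
  case: (boolP [exists x in S, #|nbhd S x| <= 1]) => [/exists_inP|].
    by left.
  by rewrite negb_exists_in => /forall_inP minS; right => z /minS; rewrite -ltnNge.
- move: Nx; rewrite leq_eqVlt => /orP[/cards1P[y Nx]|].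
    exact: card_le_ur_number_pendant Nx IH.
  rewrite ltnS leqn0 cards_eq0 => /eqP Nx.
  case: (noS [set x]); split; rewrite ?sub1set //; first by exists 0; constructor.
  apply/separatedP => a b /set1P-> /setDP[Sb]; rewrite inE eq_sym; split=> //.
  apply/negP => xb; have: b \in nbhd S x by rewrite in_nbhd Sb.
  by rewrite Nx inE.
have [u Su Nu] := degS S (subxx _) S0.
have /cards2P[v [w [vw {}Nu]]]: #|nbhd S u| == 2 by rewrite eqn_leq Nu minS.
have noS' := no_tight_component_degree2 cubG girthG minS Su vw Nu.
have [[Sv uv] [Sw uw]]: (v \in S /\ adj u v) /\ (w \in S /\ adj u w).
  have: v \in nbhd S u by rewrite Nu !inE eqxx.
  have: w \in nbhd S u by rewrite Nu !inE eqxx orbT.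
  by rewrite !in_nbhd => /andP[] ? ? /andP[].
set S' := S :\: _ in noS'.
have lt_f: ur_number S' < ur_number S.
  apply: (@ur_number_pendant _ _ u v) => //.
  - exact: subsetDl.
  - by rewrite !inE eqxx Su.
  - by rewrite !inE eqxx Sv ?orbT.
  apply/setP => b; rewrite in_nbhd in_set0; apply/negbTE/negP => /andP[/setDP[Sb]].
  have: b \in nbhd S u = (b \in [set v; w]) by rewrite Nu.
  by rewrite in_nbhd Sb !inE /= => -> /negP bX bvw; apply: bX; rewrite -orbA bvw orbT.
have lt_S: S' \proper S.
  by apply/properP; split; [exact: subsetDl | exists u; rewrite // !inE eqxx].
have leS: #|S| <= 3 + #|S'|.
  rewrite -(cardsID [set u; v; w] S) leq_add2r.
  apply: leq_trans (subset_leq_card (subsetIr _ _)) _.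
  by rewrite -setUA cardsU1 cards2; case: (_ \notin _); case: (_ != _).
have:= IH _ lt_S noS'; size_lia.
Qed.

Lemma connected_boundary T :
    connected G -> T != set0 -> T != setT ->
  exists t b, [/\ t \in T, b \notin T & adj t b].
Proof.
move=> conG /set0Pn[t Tt] TT.
have [b bT]: exists b, b \notin T.
  apply/existsP; rewrite -negb_forall; apply: contra TT => /forallP allT.
  by apply/eqP/setP => b; rewrite inE allT.
case: (boolP [exists t, [exists b, [&& t \in T, b \notin T & adj t b]]]).
  by move=> /existsP[t' /existsP[b' /and3P[]]]; exists t', b'.
move=> none; have clT: closed (@adj G) T.
  have cl p q : adj p q -> p \in T -> q \in T.
    move=> pq Tp; apply: contraNT none => Tq; apply/existsP; exists p.
    by apply/existsP; exists q; rewrite Tp Tq.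
  by move=> p q pq; apply/idP/idP; apply: cl; rewrite // adj_sym.
have /forallP/(_ t)/forallP/(_ b) := conG.
by move/(closed_connect clT); rewrite Tt (negbTE bT).
Qed.

(** In a connected graph, a vertex set other than the whole has an edge leaving
it, and the end of that edge inside has lost a neighbour. *)
Lemma degenerate_proper S : connected G -> subcubic G -> S != setT -> degenerate S.
Proof.
move=> conG cubG ST T sTS T0.
have TT: T != setT by apply: contraNneq ST => eT; rewrite -subTset -eT.
have [t [b [Tt bT tb]]] := connected_boundary conG T0 TT.
exists t => //; have := card_nbhd_le3 (b |: T) t cubG.
have -> : nbhd (b |: T) t = b |: nbhd T t.
  by apply/setP => c; rewrite !inE andb_orl; case: (eqVneq c b) => [->|] //=; rewrite tb.
by rewrite cardsU1 in_nbhd (negbTE bT).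
Qed.

(** The additive 1 pays for two kinds of graphs: tight trees, and cubic graphs,
where the first edge, at some [u], costs the four vertices [u] and its
neighbours. All other graphs are degenerate without tight components. *)
Lemma card_le_nu_ur :
  connected G -> subcubic G -> girth_at_least G 7 -> #|G| <= 3 * nu_ur G + 1.
Proof.
move=> conG cubG girthG; rewrite -ur_numberT -cardsT.
apply: (@classic_EM (exists C, tight_component C [set: G])) => -[[C [[k tC] _ sC]]|noT].
  have CT: C = setT.
    apply/eqP; apply: contraT => CT.
    have C0: C != set0 by rewrite -cards_eq0 (card_tight tC) addn1.
    have [t [b [Ct bC tb]]] := connected_boundary conG C0 CT.
    by have /separatedP/(_ t b Ct)[|_] := sC; rewrite ?inE ?bC ?tb.
  have: k + ur_number set0 <= ur_number (C :|: set0).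
    by apply: ur_number_tightU tC _; apply/separatedP => a b _; rewrite inE.
  rewrite setU0 -CT (card_tight tC); size_lia.
have noTC C : ~ tight_component C [set: G] by move=> tC; apply: noT; exists C.
case: (boolP [forall z, 3 <= #|nbhd setT z|]) => [/forallP cub|].
  have [G0|[u _]] := set_0Vmem [set: G]; first by rewrite G0 cards0.
  have noS := no_tight_component_cubic (u := u) girthG cub.
  set N := u |: nbhd setT u in noS.
  have uN: u \in N by rewrite !inE eqxx.
  have degS: degenerate (setT :\: N).
    apply: degenerate_proper => //; apply/negP => /eqP/setP/(_ u).
    by rewrite in_setD uN inE.
  have leN: #|N| <= 4.
    by rewrite cardsU1; have:= card_nbhd_le3 setT u cubG; case: (_ \notin _) => //; size_lia.
  have [v uv]: exists v, adj u v.
    have /card_gt0P[v]: 0 < #|nbhd setT u| by have := cub u; size_lia.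
    by rewrite inE => /andP[_]; exists v.
  have lt_f: ur_number (setT :\: N) < ur_number setT.
    apply: (@ur_number_pendant _ _ u v) => //.
    - by rewrite !inE eqxx.
    - by rewrite !inE uv orbT.
    apply/setP => b; rewrite in_nbhd in_set0; apply/negbTE/negP => /andP[/setDP[_]].
    by rewrite !inE negb_or => /andP[_ /negP].
  have := card_le_ur_number cubG girthG degS noS.
  rewrite -(cardsID N setT) setTI; size_lia.
rewrite negb_forall => /existsP[t]; rewrite -ltnNge => Nt.
apply: leq_trans (leq_addr 1 _); apply: card_le_ur_number => // T _ T0.
have [->|TT] := eqVneq T setT; first by exists t.
exact: degenerate_proper TT _ (subxx _) T0.
Qed.

End UniquelyRestricted.

Theorem theorem4 (G : sgraph) (n : nat)
    (conn_G : connected G) (cubic_G : subcubic G)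
    (order_G : #|G| = n) (girth_G : girth_at_least G 7) :
  ((n%:R - 1) / 3%:R <= (nu_ur G)%:R :> rat)%R.
Proof.
have := card_le_nu_ur conn_G cubic_G girth_G; rewrite order_G => le_n.
by rewrite ler_pdivrMr ?ltr0n // lerBlDr -natrM natr1 ler_nat mulnC -addn1.
Qed.
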